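(* For any positive integer $t$ and for any prime $p>t$, $$\frac{H_{p-1}^q(\{3\}^t)}{(1-q)^{3t}}\equiv\frac{1}{(t+1)p^2}\left(\binom{p+2t+1}{3t+2}+\binom{-p+2t+1}{3t+2}\right)\pmod{[p]_q}.$$
   Context: Here $q$ is an indeterminate and $[n]_q=\frac{1-q^n}{1-q}=1+q+\cdots+q^{n-1}$. For positive integers $s_1,\dots,s_l$, $$H_n^q(s_1,\ldots,s_l)=\sum_{1\le k_1<\cdots<k_l\le n}\prod_{i=1}^l\frac{q^{(s_i-1)k_i}}{[k_i]_q^{s_i}}.$$ $\{s\}^t$ denotes $t$ consecutive copies of $s$. Binomial coefficients with arbitrary (possibly negative) upper entry are $\binom{\alpha}{k}=\frac{\alpha(\alpha-1)\cdots(\alpha-k+1)}{k!}$. For a prime $p$ and rational functions $A,B$ in $q$, $A\equiv B\pmod{[p]_q}$ means $A-B=f/g$ with $f,g$ polynomials in $q$ with integer coefficients, $g$ coprime to $[p]_q$ in $\mathbb{Q}[q]$, and $[p]_q\mid f$ ($[p]_q$ is the $p$th cyclotomic polynomial, irreducible over $\mathbb{Q}$). *)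

(* Defs.v *)
From mathcomp Require Import all_boot all_order all_algebra.

Set Implicit Arguments.
Unset Strict Implicit.
Unset Printing Implicit Defensive.

Import GRing.Theory.
Local Open Scope ring_scope.

(* Q(q), with q the image of 'X. *)
Notation Qq := {fraction {poly rat}}.

Definition q : Qq := tofrac 'X.

Definition Qq_const (c : rat) : Qq := tofrac c%:P.

Definition Qq_of_intpoly (f : {poly int}) : Qq := tofrac (map_poly intr f).

Definition qint (n : nat) : {poly int} := \sum_(i < n) 'X^i.

(* H_n^q(s_1, ..., s_l) for positive s_i; the sum is over the l-tuples k with
   1 <= k_1 < ... < k_l <= n.  The natural subtraction s_i - 1 is not truncated
   since s_i > 0. *)
Definition Hq (n l : nat) (s : l.-tuple nat) : Qq :=
  \sum_(k : l.-tuple 'I_n.+1 |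
          [forall i : 'I_l, (0 < tnth k i)%N] &&
          [forall i : 'I_l, forall j : 'I_l, (i < j)%N ==> (tnth k i < tnth k j)%N])
    \prod_(i < l)
      (q ^+ ((tnth s i - 1) * tnth k i)
        / Qq_of_intpoly (qint (tnth k i)) ^+ tnth s i).

Definition gbinom (a : rat) (k : nat) : rat :=
  (\prod_(i < k) (a - i%:R)) / (k`!)%:R.

(* A = B modulo [p]_q: A - B = f / g with f, g in Z[q], g coprime to [p]_q in
   Q[q], and [p]_q dividing f.  Divisibility is taken in Z[q]; as [p]_q is monic
   this is the same as divisibility in Q[q].  (The library's %| on {poly int} is
   only divisibility up to a nonzero scalar factor.) *)
Definition qcongr (p : nat) (A B : Qq) : Prop :=
  exists f g : {poly int},
    [/\ g != 0,
        coprimep (map_poly intr g : {poly rat}) (map_poly intr (qint p)),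
        exists h : {poly int}, f = h * qint p
      & A - B = Qq_of_intpoly f / Qq_of_intpoly g].

(* Main.v *)
Require Import Defs.
From mathcomp Require Import all_boot all_order all_algebra.
From mathcomp Require Import all_field ring zify.
Import Order.TTheory GRing.Theory Num.Theory.
Local Open Scope ring_scope.

(* Two rational functions regular at the primitive pth roots of unity z are
   congruent modulo [p]_q as soon as they agree at all of them.  At q = z the
   left-hand side is the tth elementary symmetric function of the numbers
   z^(2k) / (1 - z^k)^3, 0 < k < p, so it is read off
     prod_(0 <= k < p) ((1 - z^k)^3 + x z^(2k))
       = (a^p - 1) (b^p - 1) (c^p - 1),
   where a, b, c are the roots of y |-> (1 - y)^3 + x y^2.  As abc = 1, the right
   side is (a^p + b^p + c^p) - ((ab)^p + (bc)^p + (ca)^p), and the linear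
   recurrences of these power sums give their coefficients in x as binomials. *)

(* Coefficient of x^m in a^n + b^n + c^n, where a, b, c are the roots of
   y |-> (1 - y)^3 + x y^2; equal to n/m 'C(n + 2m - 1, 3m - 1) for m > 0. *)
Definition psum_coef (n m : nat) : nat :=
  ('C(n + 2 * m, 3 * m) + 2 * 'C(n + 2 * m - 1, 3 * m))%N.

(* (-1)^m times the coefficient of x^m in a^-n + b^-n + c^-n; equal to
   n/m 'C(n + m - 1, 3m - 1) for m > 0. *)
Definition inv_psum_coef (n m : nat) : nat :=
  (2 * 'C(n + m, 3 * m) + 'C(n + m - 1, 3 * m))%N.

(** * Recurrences and power sums of the roots *)

(** The third difference of ['C(_, k.+3)] is ['C(_, k)]; terms are moved across so that no natural
    subtraction occurs. *)
Lemma bin_diff3 (N k : nat) :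
  ('C(N.+3, k.+3) + 3 * 'C(N.+1, k.+3) = 3 * 'C(N.+2, k.+3) + 'C(N, k.+3) + 'C(N, k))%N.
Proof. by rewrite !binS; lia. Qed.

(** Coefficient of x^(m+1) in s_(n+3) = (3 + x) s_(n+2) - 3 s_(n+1) + s_n, the recurrence that y^3 =
    (3 + x) y^2 - 3 y + 1 imposes on power sums. Each of the two binomials in [psum_coef] obeys it
    separately. *)
Lemma psum_coef_rec (n m : nat) :
  (psum_coef n.+3 m.+1 + 3 * psum_coef n.+1 m.+1
   = 3 * psum_coef n.+2 m.+1 + psum_coef n m.+1 + psum_coef n.+2 m)%N.
Proof.
rewrite /psum_coef.
have -> : (3 * m.+1 = (3 * m).+3)%N by lia.
have := bin_diff3 (n + 2 * m.+1) (3 * m).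
have := bin_diff3 (n + 2 * m.+1 - 1) (3 * m).
have -> : (n.+3 + 2 * m.+1 - 1 = (n + 2 * m.+1 - 1).+3)%N by lia.
have -> : (n.+2 + 2 * m.+1 - 1 = (n + 2 * m.+1 - 1).+2)%N by lia.
have -> : (n.+1 + 2 * m.+1 - 1 = (n + 2 * m.+1 - 1).+1)%N by lia.
have -> : (n.+2 + 2 * m - 1 = n + 2 * m.+1 - 1)%N by lia.
have -> : (n.+2 + 2 * m = n + 2 * m.+1)%N by lia.
rewrite !addSn; lia.
Qed.

(** The analogue for the inverse roots, where y^3 = 3 y^2 - (3 + x) y + 1. Stripping the sign (-1)^m
    makes the term coming from -x positive. *)
Lemma inv_psum_coef_rec (n m : nat) :
  (inv_psum_coef n.+3 m.+1 + 3 * inv_psum_coef n.+1 m.+1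
   = 3 * inv_psum_coef n.+2 m.+1 + inv_psum_coef n m.+1 + inv_psum_coef n.+1 m)%N.
Proof.
rewrite /inv_psum_coef.
have -> : (3 * m.+1 = (3 * m).+3)%N by lia.
have := bin_diff3 (n + m.+1) (3 * m).
have := bin_diff3 (n + m.+1 - 1) (3 * m).
have -> : (n.+3 + m.+1 - 1 = (n + m.+1 - 1).+3)%N by lia.
have -> : (n.+2 + m.+1 - 1 = (n + m.+1 - 1).+2)%N by lia.
have -> : (n.+1 + m.+1 - 1 = (n + m.+1 - 1).+1)%N by lia.
have -> : (n.+1 + m - 1 = n + m.+1 - 1)%N by lia.
have -> : (n.+1 + m = n + m.+1)%N by lia.
rewrite !addSn; lia.
Qed.

Lemma natr_rec3 (R : pzRingType) (k a b c d e : nat) :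
  (a + k * c = k * b + d + e)%N ->
  a%:R = b%:R *+ k - c%:R *+ k + d%:R + e%:R :> R.
Proof.
move=> h; apply: (addIr (k * c)%:R); rewrite -natrD h !natrD -!mulrnA ![(_ * k)%N]mulnC.
by rewrite [RHS]addrAC; congr (_ + _); rewrite addrAC subrK.
Qed.

Lemma psum_coef_small (n m : nat) : (n < m)%N -> psum_coef n m = 0%N.
Proof. by move=> h; rewrite /psum_coef !bin_small //; lia. Qed.

Lemma inv_psum_coef_small (n m : nat) : (n < m)%N -> inv_psum_coef n m = 0%N.
Proof. by move=> h; rewrite /inv_psum_coef !bin_small //; lia. Qed.

(** Cutting at degree n loses nothing, by [psum_coef_small]. *)
Definition psum_poly (R : comNzRingType) (n : nat) : {poly R} :=
  \poly_(m < n.+1) (psum_coef n m)%:R.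

Definition inv_psum_poly (R : comNzRingType) (n : nat) : {poly R} :=
  \poly_(m < n.+1) ((-1) ^+ m * (inv_psum_coef n m)%:R).

Lemma coef_psum_poly (R : comNzRingType) (n m : nat) :
  (psum_poly R n)`_m = (psum_coef n m)%:R.
Proof. by rewrite coef_poly ltnS; case: leqP => // /psum_coef_small ->. Qed.

Lemma coef_inv_psum_poly (R : comNzRingType) (n m : nat) :
  (inv_psum_poly R n)`_m = (-1) ^+ m * (inv_psum_coef n m)%:R.
Proof.
by rewrite coef_poly ltnS; case: leqP => // /inv_psum_coef_small ->; rewrite mulr0.
Qed.

Lemma psum_poly_rec (R : comNzRingType) (n : nat) :
  psum_poly R n.+3
  = 3%:R *: psum_poly R n.+2 + 'X * psum_poly R n.+2 - 3%:R *: psum_poly R n.+1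
    + psum_poly R n.
Proof.
apply/polyP => m.
rewrite coefD coefB coefD coefXM !coefZ !coef_psum_poly.
case: m => [|m] /=; first by rewrite /psum_coef !muln0 !bin0; ring.
rewrite (natr_rec3 R _ _ _ _ _ _ (psum_coef_rec n m)).
move: (psum_coef _ _)%:R (psum_coef _ _)%:R (psum_coef _ _)%:R (psum_coef _ _)%:R.
by move=> a b c d; ring.
Qed.

Lemma inv_psum_poly_rec (R : comNzRingType) (n : nat) :
  inv_psum_poly R n.+3
  = 3%:R *: inv_psum_poly R n.+2 - 3%:R *: inv_psum_poly R n.+1
    - 'X * inv_psum_poly R n.+1 + inv_psum_poly R n.
Proof.
apply/polyP => m.
rewrite coefD coefB coefB coefXM !coefZ !coef_inv_psum_poly.
case: m => [|m] /=; first by rewrite /inv_psum_coef !muln0 !bin0; ring.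
rewrite (natr_rec3 R _ _ _ _ _ _ (inv_psum_coef_rec n m)) exprS.
move: (inv_psum_coef _ _)%:R (inv_psum_coef _ _)%:R (inv_psum_coef _ _)%:R.
by move: (inv_psum_coef _ _)%:R => a b c d; ring.
Qed.

(** Newton's identities settle n = 0, 1, 2; from there on both sides obey the same recurrence. *)
Lemma psum_polyE (R : comNzRingType) (a b c x : R) (n : nat) :
  a + b + c = 3%:R + x -> a * b + b * c + c * a = 3%:R -> a * b * c = 1 ->
  a ^+ n + b ^+ n + c ^+ n = (psum_poly R n).[x].
Proof.
move=> e1 e2 e3.
have base0 : psum_poly R 0 = 3%:R%:P.
  apply/polyP => -[|m]; rewrite coef_psum_poly coefC //=.
  by rewrite psum_coef_small.
have base1 : psum_poly R 1 = 3%:R%:P + 'X.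
  apply/polyP => -[|[|m]]; rewrite coef_psum_poly coefD coefC coefX /= ?addr0 ?add0r //.
  by rewrite psum_coef_small.
have base2 : psum_poly R 2 = 3%:R%:P + 6%:R *: 'X + 'X^2.
  apply/polyP => -[|[|[|m]]];
    rewrite coef_psum_poly !coefD coefC coefZ coefX coefXn /= ?(mulr0, mulr1, addr0, add0r) //.
  by rewrite psum_coef_small.
elim/ltn_ind: n => -[_|[_|[_|n IH]]].
- by rewrite base0 hornerC !expr0; ring.
- by rewrite base1 !hornerE e1.
- rewrite base2 !hornerE.
  have -> : a ^+ 2 + b ^+ 2 + c ^+ 2
          = (a + b + c) ^+ 2 - 2%:R * (a * b + b * c + c * a) by ring.
  by rewrite e1 e2; ring.
rewrite psum_poly_rec !hornerE -!IH; try lia.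
(* Once x, 3 and 1 are written through a, b, c, the recurrence is an identity in free variables. *)
have -> : x = a + b + c - 3%:R by rewrite e1; ring.
rewrite -e2.
rewrite -[a ^+ n]mul1r -[b ^+ n]mul1r -[c ^+ n]mul1r -e3.
rewrite !exprS; ring.
Qed.

(** Meant for the products ab, bc, ca of the roots: as abc = 1, these are the inverses of c, a, b,
    and the first two elementary symmetric functions trade places. *)
Lemma inv_psum_polyE (R : comNzRingType) (a b c x : R) (n : nat) :
  a + b + c = 3%:R -> a * b + b * c + c * a = 3%:R + x -> a * b * c = 1 ->
  a ^+ n + b ^+ n + c ^+ n = (inv_psum_poly R n).[x].
Proof.
move=> e1 e2 e3.
have base0 : inv_psum_poly R 0 = 3%:R%:P.
  apply/polyP => -[|m]; rewrite coef_inv_psum_poly coefC //= ?mul1r //.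
  by rewrite inv_psum_coef_small // mulr0.
have base1 : inv_psum_poly R 1 = 3%:R%:P.
  apply/polyP => -[|[|m]]; rewrite coef_inv_psum_poly coefC.
  - by rewrite mul1r.
  - by have -> : inv_psum_coef 1 1 = 0%N by []; rewrite mulr0.
  by rewrite inv_psum_coef_small // mulr0.
have base2 : inv_psum_poly R 2 = 3%:R%:P - 2%:R *: 'X.
  apply/polyP => -[|[|[|m]]];
    rewrite coef_inv_psum_poly coefB coefC coefZ coefX.
  - by rewrite mul1r mulr0 subr0.
  - by rewrite mulN1r mulr1 sub0r.
  - by have -> : inv_psum_coef 2 2 = 0%N by []; rewrite !mulr0 subr0.
  by rewrite inv_psum_coef_small // !mulr0 subr0.
elim/ltn_ind: n => -[_|[_|[_|n IH]]].
- by rewrite base0 hornerC !expr0; ring.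
- by rewrite base1 !hornerE e1.
- rewrite base2 !hornerE.
  have -> : a ^+ 2 + b ^+ 2 + c ^+ 2
          = (a + b + c) ^+ 2 - 2%:R * (a * b + b * c + c * a) by ring.
  by rewrite e1 e2; ring.
rewrite inv_psum_poly_rec !hornerE -!IH; try lia.
have -> : x = a * b + b * c + c * a - 3%:R by rewrite e2; ring.
rewrite -e1.
rewrite -[a ^+ n]mul1r -[b ^+ n]mul1r -[c ^+ n]mul1r -e3.
rewrite !exprS; ring.
Qed.

(** * The product over the roots of unity *)

Lemma prod_sub_unity_roots (F : fieldType) (n : nat) (z a : F) :
  n.-primitive_root z -> \prod_(0 <= k < n) (a - z ^+ k) = a ^+ n - 1.
Proof.
move=> /factor_Xn_sub_1/(congr1 (horner^~ a)).
rewrite horner_prod !hornerE => <-.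
by apply: eq_bigr => k _; rewrite !hornerE.
Qed.

Lemma cubic_unity_prod (F : closedFieldType) (n : nat) (z x : F) :
  n.-primitive_root z ->
  \prod_(0 <= k < n) ((1 - z ^+ k) ^+ 3 + x * (z ^+ k) ^+ 2)
  = (psum_poly F n).[x] - (inv_psum_poly F n).[x].
Proof.
move=> zP.
(* The list holds the lower coefficients of y^3 = 1 - 3 y + (3 + x) y^2. *)
have [a] := solve_monicpoly (fun i => nth 0 [:: 1; - 3%:R; 3%:R + x] i) (isT : (0 < 3)%N).
rewrite !big_ord_recl big_ord0 /= /bump /= => Ea.
have {}Ea : a ^+ 3 = 1 - 3%:R * a + (3%:R + x) * a ^+ 2 by rewrite Ea; ring.
have a0 : a != 0.
  apply/eqP => a0; move: Ea; rewrite a0 !expr0n /= => /eqP.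
  by rewrite !mulr0 subr0 addr0 eq_sym oner_eq0.
(* The two remaining roots have sum 3 + x - a and product 1/a; [c] is then forced by the sum. *)
have [b] := solve_monicpoly (fun i => nth 0 [:: - a^-1; 3%:R + x - a] i) (isT : (0 < 2)%N).
rewrite !big_ord_recl big_ord0 /= /bump /= => Eb.
have {}Eb : b ^+ 2 = - a^-1 + (3%:R + x - a) * b by rewrite Eb; ring.
pose c := 3%:R + x - a - b.
have e1 : a + b + c = 3%:R + x by rewrite /c; ring.
have bc : b * c = a^-1.
  have -> : b * c = (3%:R + x - a) * b - b ^+ 2 by rewrite /c; ring.
  by rewrite Eb; ring.
have e3 : a * b * c = 1 by rewrite -mulrA bc divff.
have e2 : a * b + b * c + c * a = 3%:R.
  apply: (mulfI a0); rewrite mulrDr mulrDr bc divff //.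
  have -> : c = 3%:R + x - a - b by [].
  have -> : a * (a * b) + 1 + a * ((3%:R + x - a - b) * a) = 1 + (3%:R + x) * a ^+ 2 - a ^+ 3.
    by ring.
  by rewrite Ea; ring.
have fE y : (1 - y) ^+ 3 + x * y ^+ 2 = (a - y) * (b - y) * (c - y).
  have -> : (a - y) * (b - y) * (c - y)
          = a * b * c - (a * b + b * c + c * a) * y + (a + b + c) * y ^+ 2 - y ^+ 3 by ring.
  by rewrite e1 e2 e3; ring.
under eq_bigr do rewrite fE.
rewrite !big_split /= !prod_sub_unity_roots //.
rewrite -(psum_polyE F a b c) // -(inv_psum_polyE F (a * b) (b * c) (c * a)) //.
- rewrite !exprMn.
  have e3n : a ^+ n * b ^+ n * c ^+ n = 1 by rewrite -!exprMn e3 expr1n.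
  (* Inserting -1 + 1 and writing the last 1 as (abc)^n turns the right side into the expanded
     product. *)
  rewrite -[in RHS](subrK 1 (a ^+ n + b ^+ n + c ^+ n)) -[X in _ + X - _]e3n; ring.
- have -> : a * b * (b * c) + b * c * (c * a) + c * a * (a * b)
          = (a + b + c) * (a * b * c) by ring.
  by rewrite e3 e1 mulr1.
- have -> : a * b * (b * c) * (c * a) = (a * b * c) ^+ 2 by ring.
  by rewrite e3 expr1n.
Qed.

(** In characteristic zero the naturals supply more distinct roots of [P - Q] than its degree
    allows. *)
Lemma horner_inj_num (F : numFieldType) (P Q : {poly F}) :
  (forall x, P.[x] = Q.[x]) -> P = Q.
Proof.
move=> PQ; apply/eqP; rewrite -subr_eq0; apply/negPn/negP => PQ0.
have := max_poly_roots (rs := [seq i%:R | i <- iota 0 (size (P - Q))]) PQ0.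
rewrite size_map size_iota ltnn => h; suff: false by []; apply: h.
  by apply/allP => _ /mapP [i _ ->]; rewrite rootE !hornerE PQ subrr.
by rewrite map_inj_uniq ?iota_uniq // => i j /eqP; rewrite eqr_nat => /eqP.
Qed.

(** Cancel X - 1 in the factorization of X^n - 1 and evaluate the quotient at 1. *)
Lemma prod_1_sub_unity_roots (F : numFieldType) (n : nat) (z : F) :
  n.-primitive_root z -> \prod_(1 <= k < n) (1 - z ^+ k) = n%:R.
Proof.
move=> zP; have n0 := prim_order_gt0 zP.
have : \prod_(1 <= k < n) ('X - (z ^+ k)%:P) = \sum_(i < n) 'X^i.
  have X1 : ('X - 1 : {poly F}) != 0 by rewrite -polyC1 polyXsubC_eq0.
  by apply: (mulfI X1); rewrite -subrX1 -(factor_Xn_sub_1 zP) [RHS]big_ltn // expr0.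
move=> /(congr1 (horner^~ 1)); rewrite horner_prod horner_sum.
under eq_bigr do rewrite !hornerE.
move=> ->; under eq_bigr do rewrite hornerXn expr1n.
by rewrite sumr_const card_ord.
Qed.

(** In the cubic product the factor k = 0 is x itself, which shifts the index t to t+1. Pulling (1 -
    z^k)^3 out of the other factors gives n^3. *)
Lemma unity_prod_coef (F : numClosedFieldType) (n t : nat) (z : F) :
  n.-primitive_root z ->
  n%:R ^+ 3 * (\prod_(1 <= k < n) (1 + ((z ^+ k) ^+ 2 / (1 - z ^+ k) ^+ 3) *: 'X))`_t
  = (psum_coef n t.+1)%:R - (-1) ^+ t.+1 * (inv_psum_coef n t.+1)%:R.
Proof.
move=> zP; have n0 := prim_order_gt0 zP.
rewrite -coef_psum_poly -coef_inv_psum_poly -coefB -coefZ.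
suff -> : psum_poly F n - inv_psum_poly F n
  = 'X * (n%:R ^+ 3 *: \prod_(1 <= k < n) (1 + ((z ^+ k) ^+ 2 / (1 - z ^+ k) ^+ 3) *: 'X)).
  by rewrite coefXM.
apply: horner_inj_num => x.
rewrite hornerD hornerN -(cubic_unity_prod F n z x zP) big_ltn // expr0.
rewrite subrr expr0n /= add0r expr1n mulr1.
rewrite hornerM hornerX hornerZ; congr (_ * _).
rewrite horner_prod -(prod_1_sub_unity_roots F n z zP) -prodrXl -big_split /=.
rewrite big_nat_cond [RHS]big_nat_cond; apply: eq_bigr => k; rewrite andbT => /andP [k0 kn].
have u : 1 - z ^+ k != 0.
  by rewrite subr_eq0 eq_sym -(prim_order_dvd zP) gtnNdvd.
rewrite hornerD hornerC hornerZ hornerX mulrDr mulr1; congr (_ + _).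
by rewrite [RHS]mulrA [in RHS]mulrC; congr (_ * _); rewrite mulrC divfK ?expf_neq0.
Qed.

(** * Elementary symmetric functions and binomials *)

Lemma increasing_tnthE (n l : nat) (k : l.-tuple 'I_n) :
  [forall i : 'I_l, forall j : 'I_l, (i < j)%N ==> (tnth k i < tnth k j)%N]
  = sorted ltn (map val k).
Proof.
have nthE (i : 'I_l) : nth 0%N (map val k) i = tnth k i.
  by rewrite -(tnth_nth 0%N (map_tuple val k)) tnth_map.
apply/idP/idP => [/forallP h | s].
  apply/(sortedP 0%N) => i; rewrite size_map size_tuple => il.
  have /forallP/(_ (Ordinal il))/implyP := h (Ordinal (ltnW il)).
  by rewrite -!nthE /= => ->.
apply/forallP => i; apply/forallP => j; apply/implyP => ij.
rewrite -!nthE; apply: (sorted_ltn_nth ltn_trans) => //;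
  by rewrite inE size_map size_tuple.
Qed.

(** Strictly increasing tuples biject with [l]-subsets; the inverse lists a subset in increasing
    order. *)
Lemma sum_sorted_tuples (R : pzSemiRingType) (n l : nat) (F : {set 'I_n} -> R) :
  \sum_(k : l.-tuple 'I_n | sorted ltn (map val k)) F [set i in k]
  = \sum_(J : {set 'I_n} | #|J| == l) F J.
Proof.
case: n F => [|n] F.
  case: l => [|l].
    rewrite (big_pred1 [tuple]) => [|k]; last first.
      by rewrite [k]tuple0; apply/esym/eqP.
    rewrite (big_pred1 set0) => [|J]; last by rewrite cards_eq0.
    by congr F; apply/setP => i; rewrite !inE.
  rewrite big_pred0 => [|k]; last by case: (thead k).
  by rewrite big_pred0 // => J; rewrite (_ : J = set0) ?cards0 //; apply/setP => -[].
(* The default [ord0], available since the empty range was split off, is never reached when [A] has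
   [l] elements. *)
pose f_A (A : {set 'I_n.+1}) := [tuple of mkseq (nth ord0 (enum A)) l].
have val_fA (A : {set 'I_n.+1}) : #|A| = l -> val (f_A A) = enum A.
  by move=> Am; rewrite -[enum _](mkseq_nth ord0) -cardE Am.
have inc_A (A : {set 'I_n.+1}) : sorted ltn (map val (enum A)).
  rewrite -[enum _](eq_filter (mem_enum _)) -(eq_filter (mem_map val_inj _)) -filter_map.
  by rewrite (sorted_filter ltn_trans) // unlock val_ord_enum iota_ltn_sorted.
rewrite [RHS](reindex_onto (fun k : l.-tuple 'I_n.+1 => [set i in k]) f_A) /=; last first.
  by move=> A /eqP cA; apply/setP => x; rewrite inE -(mem_enum A) -val_fA.
apply: eq_bigl => k; apply/idP/idP => [s|/andP [/eqP c /eqP <-]]; last by rewrite val_fA.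
have ck : #|[set i in k]| = l.
  rewrite cardsE (card_uniqP _) ?size_tuple // -(map_inj_uniq val_inj).
  exact: (sorted_uniq ltn_trans ltnn).
rewrite ck eqxx -val_eqE val_fA //= -(inj_eq (inj_map val_inj)) /=.
apply/eqP/(irr_sorted_eq ltn_trans ltnn) => // y.
by apply/mapP/mapP => -[x kx ->]; exists x; rewrite // mem_enum inE in kx *.
Qed.

Lemma coef_prod_1DZX (R : comNzRingType) (n l : nat) (a : 'I_n -> R) :
  (\prod_(i < n) (1 + a i *: 'X))`_l
  = \sum_(J : {set 'I_n} | #|J| == l) \prod_(i in J) a i.
Proof.
under eq_bigr do rewrite addrC.
rewrite bigA_distr coef_sum [RHS]big_mkcond; apply: eq_bigr => J _.
rewrite -big_mkcond scaler_prod prodr_const coefZ coefXn eq_sym.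
by case: eqP => _; rewrite ?mulr1 ?mulr0.
Qed.

(** Both sides are the elementary symmetric function of degree [l] in the values of [a]. *)
Lemma sum_increasing_tuples (R : comNzRingType) (n l : nat) (a : 'I_n -> R) :
  \sum_(k : l.-tuple 'I_n |
      [forall i : 'I_l, forall j : 'I_l, (i < j)%N ==> (tnth k i < tnth k j)%N])
    \prod_(i < l) a (tnth k i)
  = (\prod_(i < n) (1 + a i *: 'X))`_l.
Proof.
rewrite coef_prod_1DZX -sum_sorted_tuples.
rewrite (eq_bigl _ _ (increasing_tnthE n l)); apply: eq_bigr => k ks.
rewrite -(big_tuple _ _ k predT a) big_uniq; first by apply: eq_bigl => i; rewrite inE.
rewrite -(map_inj_uniq val_inj); exact: (sorted_uniq ltn_trans ltnn).
Qed.

Lemma gbinom_nat (n k : nat) : gbinom n%:R k = 'C(n, k)%:R.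
Proof.
have k0 : (k`!)%:R != 0 :> rat by rewrite pnatr_eq0 -lt0n fact_gt0.
apply: (mulIf k0); rewrite /gbinom divfK // -natrM bin_ffact.
elim: k {k0} => [|k IH]; first by rewrite big_ord0.
rewrite big_ord_recr /= IH ffactnSr natrM.
(* Past n the truncated subtraction n - k is wrong, but the falling factorial is already zero. *)
have [kn|nk] := leqP k n; first by rewrite natrB.
by rewrite ffact_small // !mul0r.
Qed.

(** Upper negation: reverse the factors by i -> k - 1 - i and change the sign of each. *)
Lemma gbinom_neg (a : rat) (k : nat) : gbinom a k = (-1) ^+ k * gbinom (k%:R - 1 - a) k.
Proof.
rewrite /gbinom mulrA; congr (_ / _).
have -> : (-1) ^+ k = \prod_(i < k) (-1) :> rat by rewrite prodr_const card_ord.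
rewrite -big_split /= (reindex_inj rev_ord_inj) /=; apply: eq_bigr => i _.
rewrite natrB // -[i.+1]addn1 natrD; ring.
Qed.

(** The closed form n/m 'C(n + 2m - 1, 3m - 1) at m = t+1: absorption and Pascal's rule merge the
    two binomials. *)
Lemma psum_coefE (n t : nat) :
  (t.+1%:R * (psum_coef n t.+1)%:R = n%:R * gbinom (n%:R + 2 * t%:R + 1) (3 * t + 2)).
Proof.
have -> : n%:R + 2 * t%:R + 1 = (n + 2 * t + 1)%:R :> rat by rewrite -natrM -natrD natr1 addn1.
rewrite gbinom_nat -!natrM; congr (_%:R); rewrite /psum_coef.
have := mul_bin_diag (n + 2 * t.+1) (3 * t + 2).
have -> : (n + 2 * t.+1 - 1 = n + 2 * t + 1)%N by lia.
have -> : (n + 2 * t.+1 = (n + 2 * t + 1).+1)%N by lia.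
have -> : (3 * t.+1 = (3 * t + 2).+1)%N by lia.
rewrite /= binS; nia.
Qed.

(** Upper negation sends the upper entry -n + 2t + 1 to the natural number n + t, at the cost of the
    sign (-1)^(3t+2) = (-1)^t. *)
Lemma inv_psum_coefE (n t : nat) :
  (t.+1%:R * ((-1) ^+ t * (inv_psum_coef n t.+1)%:R)
   = n%:R * gbinom (- n%:R + 2 * t%:R + 1) (3 * t + 2)).
Proof.
rewrite gbinom_neg.
have -> : (3 * t + 2)%:R - 1 - (- n%:R + 2 * t%:R + 1) = (n + t)%:R :> rat.
  rewrite (natrD _ (3 * t) 2) (natrM _ 3 t) (natrD _ n t); ring.
have -> : (-1) ^+ (3 * t + 2) = (-1) ^+ t :> rat.
  by rewrite -signr_odd -[RHS]signr_odd; congr (_ ^+ _); lia.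
rewrite gbinom_nat mulrCA [RHS]mulrCA -!natrM; congr (_ * _%:R); rewrite /inv_psum_coef.
have := mul_bin_diag (n + t.+1) (3 * t + 2).
have -> : (n + t.+1 - 1 = n + t)%N by lia.
have -> : (n + t.+1 = (n + t).+1)%N by lia.
have -> : (3 * t.+1 = (3 * t + 2).+1)%N by lia.
rewrite /= binS; nia.
Qed.

(** * Evaluation at roots of unity *)

Definition evalC (f : {poly int}) (z : algC) : algC := (map_poly intr f).[z].

Lemma evalCD (f g : {poly int}) (z : algC) : evalC (f + g) z = evalC f z + evalC g z.
Proof. by rewrite /evalC rmorphD hornerD. Qed.

Lemma evalCM (f g : {poly int}) (z : algC) : evalC (f * g) z = evalC f z * evalC g z.
Proof. by rewrite /evalC rmorphM hornerM. Qed.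

Lemma evalC_qint (n : nat) (z : algC) : evalC (qint n) z = \sum_(i < n) z ^+ i.
Proof.
rewrite /evalC /qint rmorph_sum horner_sum; apply: eq_bigr => i _.
by rewrite rmorphXn /= map_polyX hornerXn.
Qed.

Lemma Qq_of_intpolyD (f g : {poly int}) :
  Qq_of_intpoly (f + g) = Qq_of_intpoly f + Qq_of_intpoly g.
Proof. by rewrite /Qq_of_intpoly !rmorphD. Qed.

Lemma Qq_of_intpolyM (f g : {poly int}) :
  Qq_of_intpoly (f * g) = Qq_of_intpoly f * Qq_of_intpoly g.
Proof. by rewrite /Qq_of_intpoly !rmorphM. Qed.

Lemma Qq_of_intpoly1 : Qq_of_intpoly 1 = 1.
Proof. by rewrite /Qq_of_intpoly !rmorph1. Qed.

Lemma Qq_of_intpoly_eq0 (f : {poly int}) : (Qq_of_intpoly f == 0) = (f == 0).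
Proof.
rewrite /Qq_of_intpoly tofrac_eq0.
by rewrite -(inj_eq (map_inj_poly (@intr_inj rat) (rmorph0 _))) rmorph0.
Qed.

(* [A] is regular at all primitive [n]th roots of unity [z], with value [a z]. *)
Definition evals (n : nat) (A : Qq) (a : algC -> algC) : Prop :=
  exists f g : {poly int}, A = Qq_of_intpoly f / Qq_of_intpoly g /\
    forall z : algC, n.-primitive_root z ->
      evalC g z != 0 /\ evalC f z = a z * evalC g z.

(** For n > 0 a primitive root exists in [algC], so nonvanishing at all of them is not a vacuous
    condition. *)
Lemma evals_denom_neq0 (n : nat) (g : {poly int}) : (0 < n)%N ->
  (forall z : algC, n.-primitive_root z -> evalC g z != 0) -> g != 0.
Proof.
move=> /C_prim_root_exists [z zP] /(_ z zP); apply: contraNneq => ->.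
by rewrite /evalC rmorph0 horner0.
Qed.

Lemma eq_evals (n : nat) (A : Qq) (a b : algC -> algC) :
  (forall z, n.-primitive_root z -> a z = b z) -> evals n A a -> evals n A b.
Proof.
move=> ab [f [g [-> h]]]; exists f, g; split=> // z zP.
by rewrite -ab //; apply: h.
Qed.

Lemma evals_intpoly (n : nat) (f : {poly int}) : evals n (Qq_of_intpoly f) (evalC f).
Proof.
exists f, 1; rewrite Qq_of_intpoly1 divr1; split=> // z _.
by rewrite /evalC rmorph1 hornerC mulr1 oner_eq0.
Qed.

Lemma evalsD (n : nat) (A B : Qq) (a b : algC -> algC) : (0 < n)%N ->
  evals n A a -> evals n B b -> evals n (A + B) (fun z => a z + b z).
Proof.
move=> n0 [f [g [-> h]]] [f' [g' [-> h']]]; exists (f * g' + f' * g), (g * g').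
have g0 : g != 0 by apply: (evals_denom_neq0 n) => // z /h [].
have g'0 : g' != 0 by apply: (evals_denom_neq0 n) => // z /h' [].
split.
  by rewrite Qq_of_intpolyD !Qq_of_intpolyM addf_div ?Qq_of_intpoly_eq0.
move=> z zP; have [u v] := h z zP; have [u' v'] := h' z zP.
rewrite evalCD !evalCM v v' mulf_neq0 //; split=> //; ring.
Qed.

Lemma evalsM (n : nat) (A B : Qq) (a b : algC -> algC) :
  evals n A a -> evals n B b -> evals n (A * B) (fun z => a z * b z).
Proof.
move=> [f [g [-> h]]] [f' [g' [-> h']]]; exists (f * f'), (g * g').
split; first by rewrite !Qq_of_intpolyM mulf_div.
move=> z zP; have [u v] := h z zP; have [u' v'] := h' z zP.
by rewrite !evalCM v v' mulf_neq0 // mulrACA.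
Qed.

Lemma evalsV (n : nat) (A : Qq) (a : algC -> algC) :
  (forall z, n.-primitive_root z -> a z != 0) ->
  evals n A a -> evals n A^-1 (fun z => (a z)^-1).
Proof.
move=> a0 [f [g [-> h]]]; exists g, f; rewrite invf_div; split=> // z zP.
have [u v] := h z zP.
by rewrite v mulf_neq0 ?a0 // mulKf ?a0.
Qed.

Lemma evalsX (n : nat) (A : Qq) (a : algC -> algC) (k : nat) :
  evals n A a -> evals n (A ^+ k) (fun z => a z ^+ k).
Proof.
move=> Aa; elim: k => [|k IH].
  rewrite expr0 -Qq_of_intpoly1; apply: (eq_evals _ _ (evalC 1)); last exact: evals_intpoly.
  by move=> z _; rewrite /evalC rmorph1 hornerC.
rewrite exprS; apply: (eq_evals _ _ (fun z => a z * a z ^+ k)); last exact: evalsM.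
by move=> z _; rewrite exprS.
Qed.

Lemma evals_sum (n : nat) (I : Type) (r : seq I) (P : pred I)
    (A : I -> Qq) (a : I -> algC -> algC) : (0 < n)%N ->
  (forall i, P i -> evals n (A i) (a i)) ->
  evals n (\sum_(i <- r | P i) A i) (fun z => \sum_(i <- r | P i) a i z).
Proof.
move=> n0 Aa; elim: r => [|i r IH].
  rewrite big_nil; apply: (eq_evals _ _ (evalC 0)).
    by move=> z _; rewrite big_nil /evalC rmorph0 horner0.
  have -> : 0 = Qq_of_intpoly 0 by apply/esym/eqP; rewrite Qq_of_intpoly_eq0.
  exact: evals_intpoly.
rewrite big_cons; have [Pi|/negPf nPi] := boolP (P i); last first.
  by apply: eq_evals IH => z _; rewrite big_cons nPi.
apply: eq_evals (evalsD _ _ _ _ _ n0 (Aa i Pi) IH) => z _.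
by rewrite big_cons Pi.
Qed.

Lemma evals_prod (n : nat) (I : Type) (r : seq I) (P : pred I)
    (A : I -> Qq) (a : I -> algC -> algC) :
  (forall i, P i -> evals n (A i) (a i)) ->
  evals n (\prod_(i <- r | P i) A i) (fun z => \prod_(i <- r | P i) a i z).
Proof.
move=> Aa; elim: r => [|i r IH].
  rewrite big_nil -Qq_of_intpoly1; apply: (eq_evals _ _ (evalC 1)).
    by move=> z _; rewrite big_nil /evalC rmorph1 hornerC.
  exact: evals_intpoly.
rewrite big_cons; have [Pi|/negPf nPi] := boolP (P i); last first.
  by apply: eq_evals IH => z _; rewrite big_cons nPi.
apply: eq_evals (evalsM _ _ _ _ _ (Aa i Pi) IH) => z _.
by rewrite big_cons Pi.
Qed.

Lemma evals_const (n : nat) (c : rat) : evals n (Qq_const c) (fun=> ratr c).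
Proof.
exists (numq c)%:P, (denq c)%:P; rewrite /evalC /Qq_of_intpoly /Qq_const !map_polyC /=.
have d0 : (denq c)%:~R != 0 :> rat by rewrite intr_eq0 denq_neq0.
split=> [|z _].
  apply: (canRL (mulfK _)); first by rewrite tofrac_eq0 polyC_eq0.
  by rewrite -tofracM -polyCM -{1}[c]divq_num_den divfK.
rewrite !hornerC intr_eq0 denq_neq0; split=> //.
by rewrite /ratr divfK // intr_eq0 denq_neq0.
Qed.

(** * Roots of [p]_q and divisibility *)

(** The order of [z] divides p, and order 1 would give the value p, which is nonzero. *)
Lemma root_qint_prim (p : nat) (z : algC) : prime p ->
  evalC (qint p) z = 0 -> p.-primitive_root z.
Proof.
move=> pr; rewrite evalC_qint => s0.
have zp : z ^+ p = 1 by apply/eqP; rewrite -subr_eq0 subrX1 s0 mulr0.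
have [m mz mp] := prim_order_exists (prime_gt0 pr) zp.
suff m1 : m != 1%N by move: mz; rewrite (prime_nt_dvdP pr m1 mp).
apply: contra_eq_neq s0 => m1; move: (prim_expr_order mz); rewrite m1 expr1 => ->.
under eq_bigr do rewrite expr1n.
by rewrite sumr_const card_ord pnatr_eq0 -lt0n prime_gt0.
Qed.

Lemma qintE (n : nat) : qint n = \poly_(i < n) 1.
Proof. by rewrite poly_def; apply: eq_bigr => i _; rewrite scale1r. Qed.

Lemma size_qint (n : nat) : size (qint n) = n.
Proof.
case: n => [|n]; first by rewrite /qint big_ord0 size_poly0.
by rewrite qintE size_poly_eq ?oner_eq0.
Qed.

Lemma qint_monic (n : nat) : (0 < n)%N -> qint n \is monic.
Proof. by move=> n0; rewrite monicE qintE lead_coef_poly ?oner_eq0. Qed.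

(** [n]_q is monic, so division stays over the integers. The remainder has degree below n - 1 but
    vanishes at the n - 1 distinct powers z^k, hence is zero. *)
Lemma qint_dvd (n : nat) (f : {poly int}) : (0 < n)%N ->
  (forall z : algC, n.-primitive_root z -> forall k, (0 < k < n)%N -> evalC f (z ^+ k) = 0) ->
  exists h, f = h * qint n.
Proof.
move=> n0 f0; have [z zP] := C_prim_root_exists n0.
have mon := qint_monic n n0.
pose r := Pdiv.CommonRing.rmodp f (qint n).
exists (Pdiv.CommonRing.rdivp f (qint n)).
have fE := Pdiv.RingMonic.rdivp_eq mon f; rewrite {1}fE.
suff r0 : r = 0 by rewrite -/r r0 addr0.
have r_small : (size r < n)%N.
  by rewrite -[X in (_ < X)%N](size_qint n) Pdiv.CommonRing.ltn_rmodp monic_neq0.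
apply/eqP; rewrite -(inj_eq (map_inj_poly (@intr_inj algC) (rmorph0 _))) rmorph0.
apply/negPn/negP => rn0.
have := max_poly_roots (rs := [seq z ^+ k | k <- iota 1 n.-1]) rn0.
rewrite size_map size_iota size_map_inj_poly ?rmorph0 //; last exact: intr_inj.
suff -> : all (root (map_poly intr r)) [seq z ^+ k | k <- iota 1 n.-1].
  have -> : uniq [seq z ^+ k | k <- iota 1 n.-1].
    rewrite map_inj_in_uniq ?iota_uniq // => i j; rewrite !mem_iota => hi hj /eqP.
    by rewrite (eq_prim_root_expr zP) !modn_small; [move/eqP | lia | lia].
  by move=> /(_ isT isT) /leq_ltn_trans /(_ r_small); rewrite prednK // ltnn.
apply/allP => y /mapP [k]; rewrite mem_iota => hk ->; apply/rootP.
have kn : (0 < k < n)%N by lia.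
have := f0 z zP k kn; rewrite {1}fE evalCD evalCM => fk.
suff q0 : evalC (qint n) (z ^+ k) = 0 by move: fk; rewrite q0 mulr0 add0r.
rewrite evalC_qint.
have zk : z ^+ k - 1 != 0.
  by rewrite subr_eq0 -(prim_order_dvd zP) gtnNdvd //; case/andP: kn.
apply: (mulfI zk); rewrite -subrX1 mulr0.
by rewrite exprAC (prim_expr_order zP) expr1n subrr.
Qed.

Lemma evals_qcongr (p : nat) (A B : Qq) : prime p ->
  evals p (A - B) (fun=> 0) -> qcongr p A B.
Proof.
move=> pr [f [g [AB h]]]; exists f, g; split=> //.
- by apply: (evals_denom_neq0 p) => [|z /h []//]; apply: prime_gt0.
(* Coprimality may be tested over [algC], where it means having no common root. *)
- rewrite -(coprimep_map (ratr : rat -> algC)) -!map_poly_comp.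
  rewrite coprimep_sym; apply/Pdiv.ClosedField.coprimepP => z /rootP.
  have ratr_intr (u : {poly int}) : map_poly (ratr \o intr : int -> algC) u = map_poly intr u.
    by apply: eq_map_poly => i /=; rewrite ratr_int.
  rewrite !ratr_intr => /(root_qint_prim p z pr) /h [gz _]; exact: gz.
apply: qint_dvd; first exact: prime_gt0.
move=> z zP k /andP [k0 kp].
have zk : p.-primitive_root (z ^+ k).
  by rewrite (prim_root_exp_coprime _ zP) coprime_sym prime_coprime // gtnNdvd.
by have [_ ->] := h _ zk; rewrite mul0r.
Qed.

(** * Comparison of the two sides *)

(** The factor p/(t+1) of both closed forms, divided by p^3, leaves 1/((t+1) p^2). *)
Lemma psum_gbinom (p t : nat) : (0 < p)%N ->
  1 / ((t + 1)%:R * p%:R ^+ 2) *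
    (gbinom (p%:R + 2 * t%:R + 1) (3 * t + 2) + gbinom (- p%:R + 2 * t%:R + 1) (3 * t + 2))
  = (p%:R ^+ 3)^-1 * ((psum_coef p t.+1)%:R - (-1) ^+ t.+1 * (inv_psum_coef p t.+1)%:R).
Proof.
move=> p0; have p_neq0 : p%:R != 0 :> rat by rewrite pnatr_eq0 -lt0n.
have t_neq0 : t.+1%:R != 0 :> rat by rewrite pnatr_eq0.
apply: (mulfI t_neq0); apply: (mulfI (expf_neq0 3 p_neq0)).
rewrite [RHS]mulrCA mulVKf ?expf_neq0 // [(-1) ^+ _]exprS mulN1r mulNr opprK [RHS]mulrDr.
rewrite psum_coefE inv_psum_coefE -mulrDr addn1.
move: (_ + _) => G; by field; rewrite p_neq0 nat1r.
Qed.

(** At q = z, [k]_q is (1 - z^k)/(1 - z), so each factor is (1 - z)^3 times [a k] and the power (1 -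
    z)^(3t) cancels. *)
Lemma sum_unity_tuples (n t : nat) (z : algC) : (1 < n)%N -> n.-primitive_root z ->
  (\sum_(k : t.-tuple 'I_(n - 1).+1 |
      [forall i : 'I_t, (0 < tnth k i)%N] &&
      [forall i : 'I_t, forall j : 'I_t, (i < j)%N ==> (tnth k i < tnth k j)%N])
    \prod_(i < t) (z ^+ (2 * tnth k i) / evalC (qint (tnth k i)) z ^+ 3))
  / (1 - z) ^+ (3 * t)
  = (n%:R ^+ 3)^-1 * ((psum_coef n t.+1)%:R - (-1) ^+ t.+1 * (inv_psum_coef n t.+1)%:R).
Proof.
move=> n1 zP; have nE : (n - 1).+1 = n by lia.
have z1 : 1 - z != 0.
  by rewrite subr_eq0 eq_sym -[z]expr1 -(prim_order_dvd zP) gtnNdvd.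
have n_neq0 : n%:R ^+ 3 != 0 :> algC by rewrite expf_neq0 // pnatr_eq0; lia.
pose a (j : 'I_(n - 1).+1) := (z ^+ j) ^+ 2 / (1 - z ^+ j) ^+ 3.
have aE (k : 'I_(n - 1).+1) :
    z ^+ (2 * k) / evalC (qint k) z ^+ 3 = (1 - z) ^+ 3 * a k.
  rewrite evalC_qint.
  have -> : \sum_(i < k) z ^+ i = (1 - z ^+ k) / (1 - z).
    by apply: (canRL (mulfK z1)); rewrite mulrC -opprB mulNr -subrX1 opprB.
  by rewrite expr_div_n invf_div /a mulnC exprM mulrCA mulrA.
rewrite big_mkcondl /= (eq_bigr (fun k => (1 - z) ^+ (3 * t) * \prod_(i < t) a (tnth k i))).
  rewrite -mulr_sumr mulrAC divff ?expf_neq0 // mul1r sum_increasing_tuples.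
  apply: (mulfI n_neq0); rewrite mulVKf // -(unity_prod_coef _ _ _ _ zP).
  congr (_ * _`__).
  rewrite -(big_mkord xpredT (fun k => 1 + ((z ^+ k) ^+ 2 / (1 - z ^+ k) ^+ 3) *: 'X)).
  (* For the same reason the factor k = 0 of the product is 1. *)
  by rewrite nE big_ltn ?expr0 ?subrr ?expr0n ?invr0 ?mulr0 ?scale0r ?addr0 ?mul1r //; lia.
move=> k _; case: ifPn => [_|].
  under eq_bigr do rewrite aE.
  by rewrite big_split /= prodr_const card_ord -exprM.
rewrite negb_forall => /existsP [i]; rewrite -eqn0Ngt => /eqP ki.
by rewrite (bigD1 i) //= /a ki expr0 subrr expr0n invr0 !(mulr0, mul0r).
Qed.

Theorem theorem5p1 (t p : nat) (ht : (0 < t)%N) (hp : prime p) (htp : (t < p)%N) :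
  qcongr p
    (Hq (p - 1) (nseq_tuple t 3%N) / (1 - q) ^+ (3 * t))
    (Qq_const
       (1 / ((t + 1)%:R * p%:R ^+ 2) *
        (gbinom (p%:R + 2 * t%:R + 1) (3 * t + 2)
         + gbinom (- p%:R + 2 * t%:R + 1) (3 * t + 2)))).
Proof.
have p0 := prime_gt0 hp; apply: evals_qcongr => //.
rewrite psum_gbinom //; set c := (X in Qq_const X).
have qE : q = Qq_of_intpoly 'X by rewrite /q /Qq_of_intpoly map_polyX.
have eq_q : evals p q id.
  rewrite qE; apply: eq_evals (evals_intpoly _ _) => z _.
  by rewrite /evalC map_polyX hornerX.
have ev1q : evals p (1 - q) (fun z => 1 - z).
  have -> : 1 - q = Qq_of_intpoly (1 - 'X).
    by rewrite /Qq_of_intpoly !rmorphB !rmorph1 /= map_polyX.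
  apply: eq_evals (evals_intpoly _ _) => z _.
  by rewrite /evalC rmorphB rmorph1 /= map_polyX hornerD hornerN hornerC hornerX.
have z_neq1 (z : algC) k : p.-primitive_root z -> (0 < k < p)%N -> 1 - z ^+ k != 0.
  by move=> zP /andP [k0 kp]; rewrite subr_eq0 eq_sym -(prim_order_dvd zP) gtnNdvd.
have evH : evals p (Hq (p - 1) (nseq_tuple t 3%N)) (fun z =>
    \sum_(k : t.-tuple 'I_(p - 1).+1 |
      [forall i : 'I_t, (0 < tnth k i)%N] &&
      [forall i : 'I_t, forall j : 'I_t, (i < j)%N ==> (tnth k i < tnth k j)%N])
    \prod_(i < t) (z ^+ (2 * tnth k i) / evalC (qint (tnth k i)) z ^+ 3)).
  apply: evals_sum => // k /andP [/forallP kpos _].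
  apply: evals_prod => i _; rewrite tnth_nseq.
  apply: evalsM; first exact: evalsX.
  apply: evalsV; last by apply: evalsX; apply: evals_intpoly.
  (* Since 0 < k_i < p, z^(k_i) differs from 1, so [k_i]_q does not vanish at z and may be
     inverted. *)
  move=> z zP; rewrite expf_neq0 // evalC_qint.
  have kp : (0 < tnth k i < p)%N by rewrite kpos; have := ltn_ord (tnth k i); lia.
  have := z_neq1 z _ zP kp; apply: contraNneq => s0.
  by rewrite -opprB subrX1 s0 mulr0 oppr0.
have evN : evals p (- Qq_const c) (fun=> - ratr c).
  rewrite /Qq_const -tofracN -polyCN -rmorphN; exact: evals_const.
have z1 (z : algC) : p.-primitive_root z -> (1 - z) ^+ (3 * t) != 0.
  by move=> zP; rewrite expf_neq0 // -[z]expr1 z_neq1 // prime_gt1.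
apply: eq_evals (evalsD _ _ _ _ _ p0 (evalsM _ _ _ _ _ evH
  (evalsV _ _ _ z1 (evalsX _ _ _ (3 * t) ev1q))) evN).
move=> z zP; rewrite sum_unity_tuples ?prime_gt1 //; apply/eqP; rewrite subr_eq0; apply/eqP.
by rewrite /c rmorphM fmorphV rmorphXn rmorphB rmorphM rmorph_sign /= !ratr_nat.
Qed.
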